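(* Fix $q\ge2$, $\boldsymbol\beta=(\beta_1,\dots,\beta_{q-1})'\in\mathbb{R}^{q-1}$, and a connected constraint graph $H\ne K_q^+$ with vertex set $\{0,1,\dots,q-1\}$ that has an unconstrained vertex. For each $N\in\mathbb{N}$ let $G_N$ be a graph on $N$ vertices, and suppose $\sup_{N\ge1}\frac1N\sum_{u=1}^N d_u(G_N)<\infty$. Then, given a sample $\vec\sigma\sim\mathbb{P}^N_{\boldsymbol\beta}$ from the $H$-coloring model on $G_N$, any sequence of MPL estimates $\{\hat{\boldsymbol\beta}^N(\vec\sigma)\}_{N\in\mathbb{N}}$ is $\sqrt N$-consistent for $\boldsymbol\beta$, that is, $$\lim_{M\to\infty}\limsup_{N\to\infty}\mathbb{P}^N_{\boldsymbol\beta}\big(\sqrt N\,\|\hat{\boldsymbol\beta}^N(\vec\sigma)-\boldsymbol\beta\|_2>M\big)=0.$$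
   Context: Each $G_N$ is a finite simple graph with vertex set $\{1,\dots,N\}$ and no isolated vertices; $d_u(G_N)$ is the degree of $u$. A constraint graph $H$ has vertex set (colors) $\{0,1,\dots,q-1\}$, possibly with self-loops but no multiple edges. A vertex $s$ of $H$ is unconstrained if $(s,t)\in E(H)$ for all $t\in V(H)$ (including $t=s$). $K_q^+$ is the complete graph on $\{0,\dots,q-1\}$ with a self-loop at every vertex. $\Omega_{G_N}(H)$ is the set of $\vec\sigma\in\{0,\dots,q-1\}^N$ such that $(u,v)\in E(G_N)$ implies $(\sigma_u,\sigma_v)\in E(H)$. With $\beta_0:=0$ and $c^N_s(\vec\sigma)=|\{u:\sigma_u=s\}|$, the $H$-coloring model is the probability measure on $\Omega_{G_N}(H)$ with $\mathbb{P}^N_{\boldsymbol\beta}(\vec\sigma)\propto\exp\{\sum_{s=1}^{q-1}\beta_s c^N_s(\vec\sigma)\}$. An MPL (maximum pseudo-likelihood) estimate $\hat{\boldsymbol\beta}^N(\vec\sigma)$ is any critical point over $\boldsymbol b\in\mathbb{R}^{q-1}$ of the log pseudo-likelihood $\boldsymbol b\mapsto\log\prod_{u=1}^N\mathbb{P}^N_{\boldsymbol b}(\sigma_u\mid(\sigma_v)_{v\ne u})$, where the factor is the conditional probability under $\mathbb{P}^N_{\boldsymbol b}$ of the observed $\sigma_u$ given the other coordinates; on configurations for which no critical point exists the value is arbitrary. $\|\cdot\|_2$ is the Euclidean norm. *)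

(* Defs.v *)
From HB Require Import structures.
From mathcomp Require Import all_boot all_order all_algebra.
From mathcomp Require Import all_classical all_reals all_analysis.

Set Implicit Arguments.
Unset Strict Implicit.
Unset Printing Implicit Defensive.

Import Order.TTheory GRing.Theory Num.Theory.
Import numFieldNormedType.Exports.

Local Open Scope ring_scope.

Definition simple_graph (V : finType) (G : rel V) : Prop :=
  symmetric G /\ irreflexive G.

Definition degree (V : finType) (G : rel V) (u : V) : nat :=
  #|[set v | G u v]|.

Definition no_isolated_vertex (V : finType) (G : rel V) : Prop :=
  forall u, exists v, G u v.

Definition connected_graph (V : finType) (H : rel V) : Prop :=
  forall s t, connect H s t.

Definition unconstrained (V : finType) (H : rel V) (s : V) : Prop :=
  forall t, H s t.

Definition complete_looped (V : finType) : rel V := fun _ _ => true.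

(* A constraint graph on the colors {0, ..., q-1} is a symmetric relation
   [H : rel 'I_q], not necessarily irreflexive. *)

Definition coloring (q N : nat) := {ffun 'I_N -> 'I_q}.

Definition hcolorings (q N : nat) (H : rel 'I_q) (G : rel 'I_N) :
    {set coloring q N} :=
  [set x : coloring q N | [forall u, forall v, G u v ==> H (x u) (x v)]].

Definition color_count (q N : nat) (s : nat) (x : coloring q N) : nat :=
  #|[set u | x u == s :> nat]|.

(* The parameter [b] is indexed from 0: [b 0 i] is the weight of color [i.+1],
   and color 0 has weight 0. *)
Definition hcol_weight (R : realType) (q N : nat) (b : 'rV[R]_q.-1)
    (x : coloring q N) : R :=
  expR (\sum_(i < q.-1) b 0 i * (color_count i.+1 x)%:R).

Definition hcol_partition (R : realType) (q N : nat) (H : rel 'I_q)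
    (G : rel 'I_N) (b : 'rV[R]_q.-1) : R :=
  \sum_(x in hcolorings H G) hcol_weight b x.

Definition hcol_pmf (R : realType) (q N : nat) (H : rel 'I_q) (G : rel 'I_N)
    (b : 'rV[R]_q.-1) (x : coloring q N) : R :=
  if x \in hcolorings H G then hcol_weight b x / hcol_partition H G b else 0.

Definition hcol_prob (R : realType) (q N : nat) (H : rel 'I_q) (G : rel 'I_N)
    (b : 'rV[R]_q.-1) (A : pred (coloring q N)) : R :=
  \sum_(x | A x) hcol_pmf H G b x.

(* Conditional probability of the color [x u] at [u] given the colors [x v] at
   all [v != u]. *)
Definition hcol_cond_prob (R : realType) (q N : nat) (H : rel 'I_q)
    (G : rel 'I_N) (b : 'rV[R]_q.-1) (x : coloring q N) (u : 'I_N) : R :=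
  hcol_prob H G b (pred1 x) /
  hcol_prob H G b (fun y => [forall v, (v != u) ==> (y v == x v)]).

Definition log_pseudo_likelihood (R : realType) (q N : nat) (H : rel 'I_q)
    (G : rel 'I_N) (x : coloring q N) (b : 'rV[R]_q.-1) : R :=
  ln (\prod_(u < N) hcol_cond_prob H G b x u).

Definition critical_point (R : realType) (n : nat) (f : 'rV[R]_n -> R)
    (b : 'rV[R]_n) : Prop :=
  differentiable f b /\ forall v, 'd f b v = 0.

(* Any value is allowed on configurations whose log pseudo-likelihood has no
   critical point. *)
Definition mpl_estimate (R : realType) (q N : nat) (H : rel 'I_q)
    (G : rel 'I_N) (bhat : coloring q N -> 'rV[R]_q.-1) : Prop :=
  forall x, x \in hcolorings H G ->
    (exists b : 'rV[R]_q.-1, critical_point (log_pseudo_likelihood H G x) b) ->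
    critical_point (log_pseudo_likelihood H G x) (bhat x).

(* The library norm on row vectors is the sup norm. *)
Definition norm2 (R : realType) (n : nat) (v : 'rV[R]_n) : R :=
  Num.sqrt (\sum_i v 0 i ^+ 2).

(* Main.v *)
Require Import Defs.
From HB Require Import structures.
From mathcomp Require Import all_boot all_order all_algebra.
From mathcomp Require Import all_classical all_reals all_analysis.
From mathcomp Require Import ring lra.

Set Implicit Arguments.
Unset Strict Implicit.
Unset Printing Implicit Defensive.

Import Order.TTheory GRing.Theory Num.Theory.
Import numFieldNormedType.Exports.

Local Open Scope classical_set_scope.
Local Open Scope ring_scope.

(* The log pseudo-likelihood L is a sum over vertices of log-sum-exp terms, with
   explicit affine majorants.  Near beta it satisfies
     L(beta + a) <= L(beta) + sum_s a_s S_s - (1/8) sum_u Var_u(a),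
   where S_s is the total excess of color s over its conditional probability and
   Var_u(a) is the conditional variance of a at u.
   The excesses at non-adjacent vertices are uncorrelated, so bounded average
   degree gives E S_s^2 = O(N).  The unconstrained color is always allowed, so
   each vertex colored s contributes to the variance between s and that color;
   hence the quadratic term is of order N |a|^2 once every color occurs at least
   eps N times.  The latter fails with probability O(eps): recoloring a
   low-degree vertex with s and its neighbors with the unconstrained color costs
   only a constant factor, and there are at least N/2 vertices to choose from.
   On the good event L < L(beta) on the sphere of radius M / sqrt N around beta,
   so by concavity a critical point exists and all of them lie inside. *)

(** * Critical points of functions with affine majorants *)

Lemma is_derive_line (R : realType) (n : nat) (f : 'rV[R]_n -> R)
    (c v : 'rV[R]_n) (t : R) : differentiable f (c + t *: v) ->
  is_derive t 1 (fun s : R => f (c + s *: v)) ('d f (c + t *: v) v).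
Proof.
move=> df.
have E : forall h : R, f (c + (h *: 1 + t) *: v) = f (h *: v + (c + t *: v)).
  by move=> h; rewrite [h *: 1]mulr1 scalerDl addrCA.
have [dv ev] : derivable f (c + t *: v) v /\ 'D_v f (c + t *: v) = 'd f (c + t *: v) v.
  by split; [exact: diff_derivable|rewrite deriveE].
apply: DeriveDef.
  by move: dv; rewrite /derivable; under eq_fun do rewrite /= -E.
by rewrite -ev /derive; under [in RHS]eq_fun do rewrite /= -E.
Qed.

Section Supergradient.
Variables (R : realType) (n : nat) (f : 'rV[R]_n -> R).
Variable (D : 'rV[R]_n -> 'rV[R]_n -> R).
Hypothesis D_scale : forall b k a, D b (k *: a) = k * D b a.
Hypothesis f_diff : forall b, differentiable f b.
Hypothesis f_super : forall b a, f (b + a) <= f b + D b a.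

(** By [f_super], subtracting the linear term [t * D b a] from [f] along the line leaves a function
    with its maximum at [t = 0]. Its derivative there vanishes, which identifies [D b] with the
    differential of [f] at [b]. *)
Lemma critical_supergradient0 b : critical_point f b -> forall a, D b a = 0.
Proof.
move=> [_ crit] a.
pose h (t : R) : R := f (b + t *: a) - t * D b a.
have hd (t : R) : is_derive t 1 h ('d f (b + t *: a) a - D b a).
  have := is_derive_line (c := b) (v := a) (t := t) (f_diff _) => ?.
  apply: is_derive_eq; rewrite /GRing.scale /=; ring.
have : is_derive (0 : R) 1 h 0.
  apply: (@derive1_at_max _ h (-1) 1) => //.
  - by rewrite in_itv /= oppr_lt0 ltr01.
  - by move=> t _; rewrite /h scale0r addr0 mul0r subr0 lerBlDr -D_scale.
move=> h0; have := @derive_val _ _ _ _ _ _ _ (hd 0).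
rewrite derive_val scale0r addr0 crit; lra.
Qed.

Lemma critical_is_max b : critical_point f b -> forall a, f a <= f b.
Proof.
move=> crit a; have := f_super b (a - b).
by rewrite addrC subrK critical_supergradient0// addr0.
Qed.

(** The majorant is taken at the intermediate point and evaluated at both endpoints; in the weighted
    sum the two linear terms cancel. *)
Lemma supergradient_concave b c (t : R) : 0 <= t <= 1 ->
  (1 - t) * f b + t * f c <= f (b + t *: (c - b)).
Proof.
move=> /andP[t0 t1]; set m := b + _.
have eb : m + (- t) *: (c - b) = b by rewrite /m scaleNr addrK.
have ec : m + (1 - t) *: (c - b) = c.
  by rewrite /m -addrA -scalerDl [t + _]addrC subrK scale1r addrC subrK.
have := f_super m ((- t) *: (c - b)); have := f_super m ((1 - t) *: (c - b)).
rewrite eb ec !D_scale; move: (f _) (f _) (f m) (D _ _) => u v w d; nra.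
Qed.

(** Existence: the maximum over the closed ball cannot lie on the sphere, so it is interior and
    hence critical. Location: every critical point is a global maximum, and concavity forbids one
    beyond a sphere on which [f] is below [f b0]. *)
Lemma critical_near (b0 : 'rV[R]_n) (r : R) : 0 < r ->
  (forall a, `|a| = r -> f (b0 + a) < f b0) ->
  (exists b, critical_point f b) /\
  (forall b, critical_point f b -> `|b - b0| < r).
Proof.
move=> r0 sphere; split; last first.
  move=> b crit; rewrite ltNge; apply/negP => rb.
  (* The segment from [b0] to [b] meets the sphere at parameter [r / |b - b0|]. Concavity and
     [f b0 <= f b] make [f] at least [f b0] there, a contradiction. *)
  have b0_lt : 0 < `|b - b0| by apply: lt_le_trans rb.
  have tI : 0 <= r / `|b - b0| <= 1.
    by rewrite divr_ge0 ?(ltW r0)//= ler_pdivrMr// mul1r.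
  have := supergradient_concave b0 b tI.
  have := sphere ((r / `|b - b0|) *: (b - b0)).
  rewrite normrZ ger0_norm ?(andP tI).1// divfK ?gt_eqF// => /(_ erefl).
  have := critical_is_max crit b0; move: tI => /andP[].
  move: (r / _) (f _) (f b) (f b0) => t u v w; nra.
pose A : set 'rV[R]_n := [set b | `|b - b0| <= r].
have A0 : A !=set0 by exists b0; rewrite /A /= subrr normr0 ltW.
have cA : compact A.
  apply: bounded_closed_compact.
    exists (r + `|b0|); split=> [|x xr b]; first exact: num_real.
    rewrite /A /= => br.
    rewrite -[b](subrK b0) (le_trans (ler_normD _ _))// (le_trans _ (ltW xr))//.
    by rewrite lerD2r.
  have -> : A = (fun b => `|b - b0|) @^-1` [set x | x <= r] by [].
  apply: closed_comp; last exact: closed_le.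
  move=> x _; apply: continuous_comp; last exact: norm_continuous.
  by apply: continuousB; [exact: cvg_id|exact: cst_continuous].
have cf : {within A, continuous f}.
  by apply: continuous_subspaceT => x; exact: differentiable_continuous.
have [c cA' cmax] := EVT_max_rV A0 cA cf.
have {}cA' : `|c - b0| <= r by move: cA'; rewrite inE.
exists c; split=> // v.
have fb0 : f b0 <= f c by apply: cmax; rewrite inE /A /= subrr normr0 ltW.
have cr : `|c - b0| < r.
  rewrite lt_neqAle cA' andbT; apply/eqP => /sphere.
  by rewrite addrC subrK ltNge fb0.
(* For [|t| <= e] the point [c + t *: v] stays in the ball; the [+ 1] covers [v = 0]. *)
pose e := (r - `|c - b0|) / (`|v| + 1).
have v1 : 0 < `|v| + 1 by rewrite ltr_wpDl.
have e0 : 0 < e by rewrite divr_gt0// subr_gt0.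
have hd (t : R) := is_derive_line (c := c) (v := v) (t := t) (f_diff _).
have : is_derive (0 : R) 1 (fun t : R => f (c + t *: v)) 0.
  apply: (@derive1_at_max _ _ (- e) e) => //.
  - by rewrite ge0_cp // ltW.
  - by rewrite in_itv /= oppr_lt0 e0.
  - move=> t; rewrite in_itv /= => te; rewrite scale0r addr0.
    apply: cmax; rewrite inE /A /= addrAC (le_trans (ler_normD _ _))//.
    rewrite normrZ -lerBrDl.
    have te' : `|t| <= e by rewrite ler_norml !ltW//; case/andP: te.
    apply: (@le_trans _ _ (e * (`|v| + 1))); last by rewrite divfK ?gt_eqF.
    by apply: ler_pM => //; rewrite lerDl.
move=> h0; have := @derive_val _ _ _ _ _ _ _ (hd 0).
by rewrite derive_val scale0r addr0 => <-.
Qed.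

End Supergradient.

(** * Finite Gibbs measures and bounds on the log-partition function *)

Section Gibbs.
Variables (R : realType) (T : finType) (A : pred T).
Implicit Types (theta a : T -> R).

Definition gibbs_part theta : R := \sum_(t | A t) expR (theta t).

Definition gibbs theta (t : T) : R := expR (theta t) / gibbs_part theta.

Definition gibbs_mean theta a : R := \sum_(t | A t) gibbs theta t * a t.

Definition gibbs_var theta a : R :=
  \sum_(t | A t) gibbs theta t * (a t - gibbs_mean theta a) ^+ 2.

Lemma gibbs_part_gt0 theta t : A t -> 0 < gibbs_part theta.
Proof.
move=> At; rewrite /gibbs_part (bigD1 t)//= ltr_wpDr ?expR_gt0//.
by apply: sumr_ge0 => i _; exact: expR_ge0.
Qed.

Lemma gibbs_ge0 theta t : 0 <= gibbs theta t.
Proof.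
by rewrite divr_ge0 ?expR_ge0// sumr_ge0// => i _; exact: expR_ge0.
Qed.

Lemma gibbs_sum1 theta t : A t -> \sum_(s | A s) gibbs theta s = 1.
Proof.
by move=> At; rewrite -mulr_suml divff// gt_eqF//; exact: gibbs_part_gt0 At.
Qed.

(** The numerator is at least [expR (- B)] and the partition function has at most [#|T|] terms, each
    at most [expR B]. *)
Lemma gibbs_lb theta t B : A t -> (forall s, `|theta s| <= B) ->
  expR (- B *+ 2) / #|T|%:R <= gibbs theta t.
Proof.
move=> At hB; have /andP[lo _] : - B <= theta t <= B by rewrite -ler_norml.
have -> : expR (- B *+ 2) / #|T|%:R = expR (- B) / (#|T|%:R * expR B).
  by rewrite mulr2n expRD invfM -expRN mulrCA mulrC.
have nB : 0 <= #|T|%:R * expR B by rewrite mulr_ge0 ?expR_ge0.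
rewrite /gibbs; apply: ler_pM; rewrite ?expR_ge0 ?invr_ge0 ?ler_expR//.
have Z0 := gibbs_part_gt0 theta At.
rewrite lef_pV2 ?posrE//; last first.
  by rewrite mulr_gt0 ?expR_gt0// ltr0n; apply/card_gt0P; exists t.
rewrite mulr_natl -sumr_const [leRHS](bigID A)/= ler_wpDr//.
  by apply: sumr_ge0 => i _; exact: expR_ge0.
by apply: ler_sum => i _; rewrite ler_expR; exact: le_trans (ler_norm _) (hB i).
Qed.

(** The right-hand quadratic is the square of [1 + y / 2], which is nonnegative in this range and at
    most [expR (y / 2)]. *)
Lemma expR_ge_quadratic (y : R) : -2 <= y -> 1 + y + y ^+ 2 / 4 <= expR y.
Proof.
move=> y2; have -> : y = y / 2 + y / 2 by lra.
rewrite expRD -expr2; have := expR_ge1Dx (y / 2); set e := expR _ => he.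
nra.
Qed.

(** Follows from [expR (- (z / 2)) >= 1 - z / 2] and [(1 - z / 2) * (1 + z) >= 1], the latter valid
    for [z] in [[0, 1]]. *)
Lemma expR_half_le (z : R) : 0 <= z <= 1 -> expR (z / 2) <= 1 + z.
Proof.
move=> z01; rewrite -[z / 2]opprK expRN -[leRHS]invrK.
rewrite lef_pV2 ?posrE ?expR_gt0 ?invr_gt0 //; last by lra.
apply: le_trans (expR_ge1Dx _); rewrite -[leLHS]mul1r ler_pdivrMr; [nra|lra].
Qed.

Lemma gibbs_part_add theta a : (exists t, A t) ->
  gibbs_part (fun t => theta t + a t) =
  gibbs_part theta * \sum_(t | A t) gibbs theta t * expR (a t).
Proof.
move=> [t0 At0]; rewrite mulr_sumr; apply: eq_bigr => t _.
rewrite /gibbs expRD; field; rewrite gt_eqF//; exact: gibbs_part_gt0 At0.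
Qed.

Lemma gibbs_mean_bound theta a (r : R) t : A t -> (forall s, `|a s| <= r) ->
  `|gibbs_mean theta a| <= r.
Proof.
move=> At ar; apply: le_trans (ler_norm_sum _ _ _) _.
rewrite -[r]mul1r -(gibbs_sum1 theta At) mulr_suml; apply: ler_sum => s _.
by rewrite normrM (ger0_norm (gibbs_ge0 _ _)) ler_wpM2l ?gibbs_ge0.
Qed.

Lemma gibbs_exp_center theta a :
  \sum_(t | A t) gibbs theta t * expR (a t) =
  expR (gibbs_mean theta a) *
    \sum_(t | A t) gibbs theta t * expR (a t - gibbs_mean theta a).
Proof.
rewrite mulr_sumr; apply: eq_bigr => s _.
by rewrite mulrCA -expRD addrC subrK.
Qed.

Lemma gibbs_center0 theta a t : A t ->
  \sum_(t | A t) gibbs theta t * (a t - gibbs_mean theta a) = 0.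
Proof.
move=> At; under eq_bigr do rewrite mulrBr.
by rewrite sumrB -mulr_suml (gibbs_sum1 _ At) mul1r subrr.
Qed.

(** Jensen's inequality: after centering, [expR y >= 1 + y] and the linear terms average to zero. *)
Lemma ln_gibbs_part_ge theta a t : A t ->
  ln (gibbs_part theta) + gibbs_mean theta a <=
  ln (gibbs_part (fun t => theta t + a t)).
Proof.
move=> At; have Z0 := gibbs_part_gt0 theta At.
rewrite gibbs_part_add; last by exists t.
rewrite gibbs_exp_center.
set S := \sum_(_ | _) _; have S1 : 1 <= S.
  apply: (@le_trans _ _ (\sum_(t | A t) gibbs theta t *
      (1 + (a t - gibbs_mean theta a)))); last first.
    by apply: ler_sum => s _; rewrite ler_wpM2l ?gibbs_ge0 ?expR_ge1Dx.
  under eq_bigr do rewrite mulrDr mulr1.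
  by rewrite big_split /= (gibbs_sum1 _ At) (gibbs_center0 _ _ At) addr0.
have S0 : 0 < S by lra.
rewrite !lnM ?posrE ?mulr_gt0 ?expR_gt0// expRK.
by rewrite lerD2l lerDl ln_ge0.
Qed.

(** A quantitative form of Jensen's inequality: the quadratic bound on [expR] makes the centered
    average at least [1 + V / 4], which dominates [expR (V / 8)]. *)
Lemma ln_gibbs_part_ge_var theta a t : A t -> (forall s, `|a s| <= 1) ->
  ln (gibbs_part theta) + gibbs_mean theta a + gibbs_var theta a / 8 <=
  ln (gibbs_part (fun t => theta t + a t)).
Proof.
move=> At a1; have Z0 := gibbs_part_gt0 theta At.
have := gibbs_mean_bound theta At a1; rewrite ler_norml => /andP[m1 m2].
rewrite gibbs_part_add; last by exists t.
rewrite gibbs_exp_center.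
set m := gibbs_mean theta a; set V := gibbs_var theta a.
have adev s : -2 <= a s - m <= 2.
  have := a1 s; rewrite ler_norml => /andP[]; rewrite -/m in m1 m2; lra.
set S := \sum_(_ | _) _; have S1 : 1 + V / 4 <= S.
  apply: (@le_trans _ _ (\sum_(t | A t) gibbs theta t *
      (1 + (a t - m) + (a t - m) ^+ 2 / 4))); last first.
    apply: ler_sum => s _; rewrite ler_wpM2l ?gibbs_ge0// expR_ge_quadratic//.
    by case/andP: (adev s).
  under eq_bigr do rewrite mulrDr [X in X + _]mulrDr mulr1 mulrA.
  rewrite !big_split /= (gibbs_sum1 _ At) (gibbs_center0 theta a At : _ = 0).
  by rewrite addr0 -mulr_suml.
have V0 : 0 <= V.
  by apply: sumr_ge0 => s _; rewrite mulr_ge0 ?gibbs_ge0 ?sqr_ge0.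
(* Deviations are at most 2, so [V / 4 <= 1], as [expR_half_le] requires. *)
have V4 : V <= 4.
  rewrite -[leRHS]mul1r -[X in X * _](gibbs_sum1 theta At) mulr_suml.
  apply: ler_sum => s _; rewrite ler_wpM2l ?gibbs_ge0//; move: (adev s); rewrite -/m.
  move: (a s - m) => w /andP[w1 w2].
  nra.
have S0 : 0 < S by lra.
rewrite !lnM ?posrE ?mulr_gt0 ?expR_gt0// expRK -addrA !lerD2l.
rewrite -ler_expR lnK ?posrE//; apply: le_trans S1.
have -> : V / 8 = V / 4 / 2 by lra.
by apply: expR_half_le; lra.
Qed.

Lemma gibbs_var_ge0 theta a : 0 <= gibbs_var theta a.
Proof. by apply: sumr_ge0 => s _; rewrite mulr_ge0 ?gibbs_ge0 ?sqr_ge0. Qed.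

Lemma gibbs_var_ge theta a (d : R) s t : A s -> A t ->
  d <= gibbs theta s -> d <= gibbs theta t -> 0 <= d ->
  d / 2 * (a s - a t) ^+ 2 <= gibbs_var theta a.
Proof.
move=> As At ds dt d0; have [->|st] := eqVneq s t.
  by rewrite subrr expr0n mulr0 gibbs_var_ge0.
rewrite /gibbs_var (bigD1 s)//= (bigD1 t) ?At ?(eq_sym t)//= addrA.
set m := gibbs_mean _ _; set rest := \sum_(_ | _) _.
have r0 : 0 <= rest by apply: sumr_ge0 => i _; rewrite mulr_ge0 ?gibbs_ge0 ?sqr_ge0.
rewrite ler_wpDr// {r0 rest}.
apply: (@le_trans _ _ (d * (a s - m) ^+ 2 + d * (a t - m) ^+ 2)).
  (* With [x = a s] and [y = a t]: [(x - m)^2 + (y - m)^2] exceeds [(x - y)^2 / 2] by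
     [(x + y - 2m)^2 / 2]. *)
  rewrite -mulrDr -mulrA ler_wpM2l//; have := sqr_ge0 (a s + a t - m *+ 2).
  nra.
by apply: lerD; rewrite ler_wpM2r ?sqr_ge0.
Qed.

End Gibbs.

(** * Color weights as linear functions of the parameter *)

Section ColorParam.
Variables (R : realType) (q : nat).

(** The sum has at most one term and is empty for color 0, which encodes the convention that color 0
    has weight 0. *)
Definition color_param (b : 'rV[R]_q.-1) (s : 'I_q) : R :=
  \sum_(i < q.-1 | i.+1 == s :> nat) b 0 i.

Lemma color_paramD a b s :
  color_param (a + b) s = color_param a s + color_param b s.
Proof. by rewrite -big_split; apply: eq_bigr => i _; rewrite mxE. Qed.

Lemma color_paramZ (k : R) a s : color_param (k *: a) s = k * color_param a s.
Proof. by rewrite mulr_sumr; apply: eq_bigr => i _; rewrite mxE. Qed.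

Lemma color_param0 b (s : 'I_q) : s = 0%N :> nat -> color_param b s = 0.
Proof. by move=> s0; rewrite /color_param big1// => i; rewrite s0. Qed.

Lemma color_paramS b (s : 'I_q) (i : 'I_q.-1) : s = i.+1 :> nat ->
  color_param b s = b 0 i.
Proof.
by move=> si; rewrite /color_param (big_pred1 i)// => j; rewrite si /= eqSS.
Qed.

Lemma coord_le_norm n (b : 'rV[R]_n) i : `|b 0 i| <= `|b|.
Proof.
rewrite [leRHS]/Num.norm /= mx_normrE.
exact: (le_bigmax _ (fun ij : 'I_1 * 'I_n => `|b ij.1 ij.2|) (0, i)).
Qed.

Lemma color_param_le b s : `|color_param b s| <= `|b|.
Proof.
have [s0|s_gt0] := posnP s; first by rewrite color_param0// normr0.
have hi : (s.-1 < q.-1)%N.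
  by rewrite -ltnS (prednK s_gt0) (leq_trans (ltn_ord s))// leqSpred.
by rewrite (@color_paramS _ _ (Ordinal hi)) ?coord_le_norm//= prednK.
Qed.

Lemma color_param_attains b : b != 0 ->
  exists s t : 'I_q, color_param b s = 0 /\ `|color_param b t| = `|b|.
Proof.
move=> b0; have : mx_norm b != 0 by apply: contra_neq b0; exact: mx_norm_eq0.
move=> /mx_norm_neq0[[i0 i] /= ei].
have hi : (i.+1 < q)%N by rewrite -ltn_predRL.
have h0 : (0 < q)%N by apply: leq_trans hi.
exists (Ordinal h0), (Ordinal hi); split; first exact: color_param0.
by rewrite (@color_paramS _ _ i)// [RHS]/Num.norm /= ei ord1.
Qed.

End ColorParam.

(** * Single-vertex recoloring and conditional probabilities *)

Section Model.
Variables (R : realType) (q N : nat) (H : rel 'I_q) (G : rel 'I_N).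
Hypotheses (H_sym : symmetric H) (G_sym : symmetric G) (G_irr : irreflexive G).
Implicit Types (x y : coloring q N) (u v : 'I_N) (s t : 'I_q).
Implicit Types (a b : 'rV[R]_q.-1).

Definition allowed x u : pred 'I_q :=
  fun t => [forall v, G u v ==> H t (x v)].

Definition recolor x u t : coloring q N :=
  [ffun v => if v == u then t else x v].

Lemma hcoloringsP x :
  reflect (forall u v, G u v -> H (x u) (x v)) (x \in hcolorings H G).
Proof.
rewrite inE; apply: (iffP forallP) => [h u v|h u].
  by move/forallP: (h u) => /(_ v)/implyP.
by apply/forallP => v; apply/implyP/h.
Qed.

Lemma allowedP x u t :
  reflect (forall v, G u v -> H t (x v)) (allowed x u t).
Proof.
apply: (iffP forallP) => h v; first by move/implyP: (h v).
by apply/implyP/h.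
Qed.

Lemma allowed_self x u : x \in hcolorings H G -> allowed x u (x u).
Proof. by move=> /hcoloringsP h; apply/allowedP/h. Qed.

Lemma allowed_unconstrained x u t : unconstrained H t -> allowed x u t.
Proof. by move=> h; apply/allowedP => v _; exact: h. Qed.

Lemma allowed_recolor x u v t : ~~ G u v -> allowed (recolor x v t) u =1 allowed x u.
Proof.
move=> uv s; apply: eq_forallb => w; rewrite ffunE.
by have [->|//] := eqVneq w v; rewrite (negbTE uv).
Qed.

Lemma recolor_hcolorings x u t : x \in hcolorings H G ->
  (recolor x u t \in hcolorings H G) = allowed x u t.
Proof.
move=> /hcoloringsP hx; apply/hcoloringsP/allowedP => [h v uv|h v w vw].
  move: (h u v uv); rewrite !ffunE eqxx; case: eqP => // vu.
  by move: uv; rewrite vu G_irr.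
rewrite !ffunE; have [vu|vu] := eqVneq v u; have [wu|wu] := eqVneq w u.
- by move: vw; rewrite vu wu G_irr.
- by apply: h; rewrite -vu.
- by rewrite H_sym; apply: h; rewrite -wu G_sym.
- exact: hx.
Qed.

Lemma hcol_weightE b x :
  hcol_weight b x = expR (\sum_u color_param b (x u)).
Proof.
congr expR; rewrite /color_param (exchange_big_dep xpredT)//=.
apply: eq_bigr => i _; rewrite sumr_const -[RHS]mulr_natr; congr (_ * _%:R).
by rewrite /color_count cardsE; apply: eq_card => u; exact: (eq_sym (x u : nat)).
Qed.

Lemma hcol_weight_gt0 b x : 0 < hcol_weight b x.
Proof. exact: expR_gt0. Qed.

Lemma hcol_weight_recolor b x u t :
  hcol_weight b (recolor x u t) =
  hcol_weight b x * expR (color_param b t) / expR (color_param b (x u)).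
Proof.
rewrite !hcol_weightE -expRN -!expRD; congr expR.
rewrite (bigD1 u)//= [in RHS](bigD1 u)//= ffunE eqxx.
rewrite (eq_bigr (fun v => color_param b (x v))); first by ring.
by move=> v /negbTE vu; rewrite ffunE vu.
Qed.

Lemma hcol_partition_gt0 b x : x \in hcolorings H G ->
  0 < hcol_partition H G b.
Proof.
move=> hx; rewrite /hcol_partition (bigD1 x)//= ltr_wpDr ?hcol_weight_gt0//.
by apply: sumr_ge0 => y _; exact: ltW (hcol_weight_gt0 _ _).
Qed.

Lemma hcol_pmf_ge0 b x : 0 <= hcol_pmf H G b x.
Proof.
rewrite /hcol_pmf; case: ifP => // hx.
by rewrite divr_ge0// ltW// ?hcol_weight_gt0// (hcol_partition_gt0 _ hx).
Qed.

Lemma hcol_pmf_out b x : x \notin hcolorings H G -> hcol_pmf H G b x = 0.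
Proof. by rewrite /hcol_pmf => /negbTE->. Qed.

Lemma hcol_pmf_recolor b x u t : x \in hcolorings H G -> allowed x u t ->
  hcol_pmf H G b (recolor x u t) =
  hcol_pmf H G b x * expR (color_param b t) / expR (color_param b (x u)).
Proof.
move=> hx ht; rewrite /hcol_pmf recolor_hcolorings// ht hx hcol_weight_recolor.
by rewrite -!mulrA; congr (_ * _); rewrite mulrA mulrC.
Qed.

Lemma recolor_agree x y u :
  [forall v, (v != u) ==> (y v == x v)] = (y == recolor x u (y u)).
Proof.
apply/forallP/eqP => [h|-> v].
  apply/ffunP => v; rewrite ffunE; have [->//|vu] := eqVneq v u.
  by move/implyP: (h v) => /(_ vu)/eqP.
by apply/implyP => /negbTE vu; rewrite ffunE vu.
Qed.

(** The configurations agreeing with [x] off [u] are its recolorings at [u]. Their weights differ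
    only in the factor of [u], so everything else cancels. *)
Lemma hcol_cond_probE b x u : x \in hcolorings H G ->
  hcol_cond_prob H G b x u =
  gibbs (allowed x u) (color_param b) (x u).
Proof.
move=> hx; rewrite /hcol_cond_prob /hcol_prob big_pred1_eq.
under eq_bigl do rewrite recolor_agree.
have px : 0 < hcol_pmf H G b x.
  by rewrite /hcol_pmf hx divr_gt0 ?hcol_weight_gt0// (hcol_partition_gt0 _ hx).
have -> : \sum_(y : coloring q N | y == recolor x u (y u)) hcol_pmf H G b y =
    \sum_t hcol_pmf H G b (recolor x u t).
  rewrite (reindex (recolor x u)) /=.
    by apply: eq_bigl => t; rewrite ffunE eqxx eqxx.
  exists (fun y : coloring q N => y u) => [t _|y]; first by rewrite ffunE eqxx.
  by rewrite inE => /eqP <-.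
rewrite (bigID (allowed x u)) /= [X in _ + X]big1 ?addr0; last first.
  by move=> t ht; rewrite hcol_pmf_out// recolor_hcolorings.
rewrite (eq_bigr (fun t => hcol_pmf H G b x / expR (color_param b (x u)) *
    expR (color_param b t))); last first.
  by move=> t ht; rewrite hcol_pmf_recolor// mulrAC.
rewrite -mulr_sumr /gibbs -/(gibbs_part _ _).
have Z0 := gibbs_part_gt0 (color_param b) (allowed_self u hx).
field.
by rewrite !gt_eqF ?expR_gt0.
Qed.

Lemma log_pseudo_likelihoodE b x : x \in hcolorings H G ->
  log_pseudo_likelihood H G x b =
  \sum_u (color_param b (x u) - ln (gibbs_part (allowed x u) (color_param b))).
Proof.
move=> hx; rewrite /log_pseudo_likelihood -[RHS]expRK; congr ln.
rewrite expR_sum; apply: eq_bigr => u _; rewrite hcol_cond_probE// expRB lnK//.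
by rewrite posrE (gibbs_part_gt0 _ (allowed_self u hx)).
Qed.

End Model.

Lemma differentiable_sumr (R : realType) (I : Type) (r : seq I) (P : pred I) n
    (f : I -> 'rV[R]_n -> R) (c : 'rV[R]_n) :
  (forall i, differentiable (f i) c) ->
  differentiable (fun a => \sum_(i <- r | P i) f i a) c.
Proof.
move=> df; rewrite (_ : (fun _ => _) = \sum_(i <- r | P i) f i); last first.
  by apply/funext => a; rewrite fct_sumE.
elim/big_ind : _ => // g h dg dh; exact: differentiableD.
Qed.


(** * Local behavior of the log pseudo-likelihood *)

Section Score.
Variables (R : realType) (q N : nat) (H : rel 'I_q) (G : rel 'I_N).
Hypotheses (H_sym : symmetric H) (G_sym : symmetric G) (G_irr : irreflexive G).
Implicit Types (x y : coloring q N) (u v : 'I_N) (s t : 'I_q).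
Implicit Types (a b : 'rV[R]_q.-1).

(** This explicit linear form in [a] plays the role of the supergradient [D]. *)
Definition score x b a : R :=
  \sum_u (color_param a (x u) -
    gibbs_mean (allowed H G x u) (color_param b) (color_param a)).

(** The [allowed] factor is there because [gibbs] is positive even off its predicate. *)
Definition vertex_excess b x s u : R :=
  (x u == s)%:R -
  (allowed H G x u s)%:R * gibbs (allowed H G x u) (color_param b) s.

Definition color_excess b x s : R := \sum_u vertex_excess b x s u.

Lemma scoreZ x b (k : R) a : score x b (k *: a) = k * score x b a.
Proof.
rewrite mulr_sumr; apply: eq_bigr => u _; rewrite mulrBr color_paramZ.
congr (_ - _); rewrite mulr_sumr; apply: eq_bigr => t _.
by rewrite color_paramZ mulrCA.
Qed.

(** Collecting terms by color leaves only [q] random quantities, which control the score in all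
    directions [a] at once. *)
Lemma score_excess x b a :
  score x b a = \sum_s color_param a s * color_excess b x s.
Proof.
under [RHS]eq_bigr do rewrite mulr_sumr.
rewrite exchange_big; apply: eq_bigr => u _ /=.
under [RHS]eq_bigr do rewrite mulrBr.
rewrite sumrB; congr (_ - _).
  rewrite (bigD1 (x u))//= eqxx mulr1 big1 ?addr0// => s.
  by rewrite eq_sym => /negbTE->; rewrite mulr0.
rewrite /gibbs_mean big_mkcond; apply: eq_bigr => s _.
by case: (allowed _ _ _ _ _); rewrite ?mul1r ?mul0r ?mulr0// mulrC.
Qed.

Lemma score_bound x b a :
  score x b a <= `|a| * \sum_s `|color_excess b x s|.
Proof.
rewrite score_excess mulr_sumr; apply: ler_sum => s _.
apply: le_trans (ler_norm _) _; rewrite normrM.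
by rewrite ler_wpM2r ?color_param_le.
Qed.

Lemma gibbs_part_paramD x u b a :
  gibbs_part (allowed H G x u) (color_param (b + a)) =
  gibbs_part (allowed H G x u) (fun t => color_param b t + color_param a t).
Proof. by apply: eq_bigr => t _; rewrite color_paramD. Qed.

Lemma log_pseudo_likelihood_le x b a : x \in hcolorings H G ->
  log_pseudo_likelihood H G x (b + a) <=
  log_pseudo_likelihood H G x b + score x b a.
Proof.
move=> hx; rewrite !log_pseudo_likelihoodE// -big_split; apply: ler_sum => u _ /=.
rewrite color_paramD gibbs_part_paramD.
have := ln_gibbs_part_ge (color_param b) (color_param a) (allowed_self u hx).
by move: (ln _) (ln _) (gibbs_mean _ _ _) => p p' m; lra.
Qed.

Lemma log_pseudo_likelihood_le_var x b a : x \in hcolorings H G -> `|a| <= 1 ->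
  log_pseudo_likelihood H G x (b + a) <=
  log_pseudo_likelihood H G x b + score x b a -
  (\sum_u gibbs_var (allowed H G x u) (color_param b) (color_param a)) / 8.
Proof.
move=> hx a1; rewrite !log_pseudo_likelihoodE// mulr_suml -big_split -sumrB.
apply: ler_sum => u _ /=; rewrite color_paramD gibbs_part_paramD.
have := @ln_gibbs_part_ge_var _ _ _ (color_param b) (color_param a) _
  (allowed_self u hx).
move=> /(_ (fun s => le_trans (color_param_le a s) a1)).
by move: (ln _) (ln _) (gibbs_mean _ _ _) (gibbs_var _ _ _) => p p' m w; lra.
Qed.

Lemma differentiable_color_param s b : differentiable (fun a => color_param a s) b.
Proof.
have [s0|s_gt0] := posnP s.
  rewrite (_ : (fun _ => _) = cst 0); first exact: differentiable_cst.
  by apply/funext => a; rewrite color_param0.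
have hi : (s.-1 < q.-1)%N.
  by rewrite -ltnS (prednK s_gt0) (leq_trans (ltn_ord s))// leqSpred.
rewrite (_ : (fun _ => _) = (fun a => a 0 (Ordinal hi))).
  exact: differentiable_coord.
by apply/funext => a; rewrite (@color_paramS _ _ _ _ (Ordinal hi)) ?prednK.
Qed.

Lemma differentiable_log_pseudo_likelihood x b : x \in hcolorings H G ->
  differentiable (log_pseudo_likelihood H G x) b.
Proof.
move=> hx; rewrite (_ : log_pseudo_likelihood H G x = (fun a => \sum_u
  (color_param a (x u) -
    ln (gibbs_part (allowed H G x u) (color_param a))))); last first.
  by apply/funext => a; rewrite log_pseudo_likelihoodE.
apply: differentiable_sumr => u.
apply: differentiableB; first exact: differentiable_color_param.
apply: (@differentiable_comp _ _ _ _ _ (@ln R)).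
  apply: differentiable_sumr => t.
  apply: (@differentiable_comp _ _ _ _ _ (@expR R)).
    exact: differentiable_color_param.
  apply/derivable1_diffP; exact: derivable_expR.
apply/derivable1_diffP.
by have [] := is_derive1_ln (gibbs_part_gt0 (color_param b) (allowed_self u hx)).
Qed.

Lemma gibbs_var_sum_ge x b a t (m r : R) :
  x \in hcolorings H G -> unconstrained H t ->
  (forall s, m <= (color_count s x)%:R) -> 0 <= m -> `|a| = r -> 0 < r ->
  m * (expR (- `|b| *+ 2) / q%:R) * r ^+ 2 / 8 <=
  \sum_u gibbs_var (allowed H G x u) (color_param b) (color_param a).
Proof.
move=> hx ht hm m0 ar r0; set d := _ / q%:R.
have d0 : 0 <= d by rewrite divr_ge0 ?expR_ge0.
(* At a vertex colored [s] both [s] and the unconstrained [t] are allowed, each with probability at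
   least [d]; there are at least [m] such vertices. *)
have key s : m * (d / 2 * (color_param a s - color_param a t) ^+ 2) <=
    \sum_u gibbs_var (allowed H G x u) (color_param b) (color_param a).
  apply: (@le_trans _ _ ((color_count s x)%:R *
      (d / 2 * (color_param a s - color_param a t) ^+ 2))).
    by rewrite ler_wpM2r// mulr_ge0 ?sqr_ge0 ?divr_ge0.
  rewrite mulr_natl /color_count -sumr_const big_mkcond.
  apply: ler_sum => u _; rewrite inE; case: eqP => [xu|_]; last exact: gibbs_var_ge0.
  have xus : x u = s by apply: val_inj.
  have lb t' := @gibbs_lb _ _ (allowed H G x u) (color_param b) t' `|b|.
  rewrite card_ord in lb.
  have hs : allowed H G x u s by rewrite -xus allowed_self.
  have ht' : allowed H G x u t by exact: allowed_unconstrained.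
  apply: gibbs_var_ge => //; apply: lb => // ?; exact: color_param_le.
have a0 : a != 0 by rewrite -normr_gt0 ar.
have [s [s' [es es']]] := color_param_attains a0.
have := key s; have := key s'; rewrite es.
(* The weights of [s] and [s'] differ by [r] in absolute value, so that of [t] cannot be close to
   both. Averaging the two instances of [key] then gives the constant 1/8. *)
have h4 : r ^+ 2 / 2 <=
    (color_param a s' - color_param a t) ^+ 2 + (0 - color_param a t) ^+ 2.
  rewrite -ar -es' real_normK ?num_real//.
  have := sqr_ge0 (color_param a s' - color_param a t *+ 2).
  by move: (color_param a s') (color_param a t) => p p'; nra.
have md : 0 <= m * d / 2 by rewrite !mulr_ge0.
have := ler_wpM2l md h4.
move: (_ ^+ 2) (_ ^+ 2) (_ ^+ 2) (\sum_u _) => p p' p'' S; nra.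
Qed.

(** The threshold on the excesses is where the linear gain, at most [r] times their sum, meets the
    quadratic loss; 64 is the product of the 8 in the expansion and the 8 in [gibbs_var_sum_ge]. *)
Lemma log_pseudo_likelihood_sphere x b t (m r : R) :
  x \in hcolorings H G -> unconstrained H t ->
  (forall s, m <= (color_count s x)%:R) -> 0 <= m -> 0 < r -> r <= 1 ->
  \sum_s `|color_excess b x s| < m * (expR (- `|b| *+ 2) / q%:R) * r / 64 ->
  forall a, `|a| = r ->
  log_pseudo_likelihood H G x (b + a) < log_pseudo_likelihood H G x b.
Proof.
move=> hx ht hm m0 r0 r1 hS a ar.
have a1 : `|a| <= 1 by rewrite ar.
have := log_pseudo_likelihood_le_var b hx a1.
have := gibbs_var_sum_ge b hx ht hm m0 ar r0.
have := score_bound x b a; rewrite ar.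
have : r * \sum_s `|color_excess b x s| <
    r * (m * (expR (- `|b| *+ 2) / q%:R) * r / 64).
  by rewrite ltr_pM2l.
move: (\sum_s _) (\sum_u _) (expR _ / _) (score _ _ _).
move: (log_pseudo_likelihood _ _ _ _) (log_pseudo_likelihood _ _ _ _).
move=> l l' S V d sc; rewrite expr2; nra.
Qed.

Lemma mpl_estimate_near bhat x b t (m r : R) : mpl_estimate H G bhat ->
  x \in hcolorings H G -> unconstrained H t ->
  (forall s, m <= (color_count s x)%:R) -> 0 <= m -> 0 < r -> r <= 1 ->
  \sum_s `|color_excess b x s| < m * (expR (- `|b| *+ 2) / q%:R) * r / 64 ->
  `|bhat x - b| < r.
Proof.
move=> mpl hx ht hm m0 r0 r1 hS.
have [ex near] := critical_near (scoreZ x)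
  (fun b => differentiable_log_pseudo_likelihood b hx)
  (fun b a => log_pseudo_likelihood_le b a hx) r0
  (log_pseudo_likelihood_sphere hx ht hm m0 r0 r1 hS).
exact/near/mpl.
Qed.

End Score.

(** * Orthogonality and second moments of the excesses *)

Section Moments.
Variables (R : realType) (q N : nat) (H : rel 'I_q) (G : rel 'I_N).
Hypotheses (H_sym : symmetric H) (G_sym : symmetric G) (G_irr : irreflexive G).
Variable b : 'rV[R]_q.-1.
Implicit Types (x y : coloring q N) (u v : 'I_N) (s t : 'I_q).
Implicit Types (A B : pred (coloring q N)).

Local Notation pmf := (hcol_pmf H G b).
Local Notation prob := (hcol_prob H G b).

Lemma hcol_pmf_sum1 : hcolorings H G != finset.set0 -> \sum_x pmf x = 1.
Proof.
case/set0Pn => x0 hx0.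
rewrite (bigID [in hcolorings H G]) /= [X in _ + X]big1 ?addr0; last first.
  by move=> x; exact: hcol_pmf_out.
under eq_bigr => x hx do rewrite /hcol_pmf hx.
by rewrite -mulr_suml divff// gt_eqF// (hcol_partition_gt0 _ hx0).
Qed.

Lemma hcol_prob_ge0 A : 0 <= prob A.
Proof. by apply: sumr_ge0 => x _; exact: hcol_pmf_ge0. Qed.

Lemma hcol_prob_le A B :
  (forall x, x \in hcolorings H G -> A x -> B x) -> prob A <= prob B.
Proof.
move=> AB; rewrite /hcol_prob big_mkcond [leRHS]big_mkcond.
apply: ler_sum => x _; have [hx|hx] := boolP (x \in hcolorings H G); last first.
  by rewrite hcol_pmf_out// !if_same.
by case: ifP => [/(AB _ hx)->//|_]; case: ifP => // _; exact: hcol_pmf_ge0.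
Qed.

Lemma hcol_probU A B : prob (predU A B) <= prob A + prob B.
Proof.
rewrite /hcol_prob big_mkcond [X in _ <= X + _]big_mkcond.
rewrite [X in _ <= _ + X]big_mkcond -big_split.
apply: ler_sum => x _ /=; have := hcol_pmf_ge0 H G b x.
rewrite /in_mem /=; case: (A x); case: (B x) => /= p0; lra.
Qed.

Lemma hcol_prob_exists (A : 'I_q -> pred (coloring q N)) :
  prob (fun x => [exists s, A s x]) <= \sum_s prob (A s).
Proof.
rewrite /hcol_prob; under [leRHS]eq_bigr do rewrite big_mkcond.
rewrite exchange_big big_mkcond; apply: ler_sum => x _ /=.
have p0 := hcol_pmf_ge0 H G b x.
have s0 s : 0 <= (if A s x then pmf x else 0) by case: ifP.
case: ifP => [/existsP[s As]|_]; last exact: sumr_ge0.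
by rewrite (bigD1 s)//= As lerDl sumr_ge0.
Qed.

Lemma hcol_prob_markov A (f : coloring q N -> R) (c : R) :
  (forall x, 0 <= f x) -> (forall x, x \in hcolorings H G -> A x -> c <= f x) ->
  c * prob A <= \sum_x pmf x * f x.
Proof.
move=> f0 Af; rewrite /hcol_prob big_mkcond mulr_sumr; apply: ler_sum => x _.
have p0 := hcol_pmf_ge0 H G b x.
case: ifP => [Ax|_]; last by rewrite mulr0 mulr_ge0.
have [hx|hx] := boolP (x \in hcolorings H G); last first.
  by rewrite hcol_pmf_out// mul0r mulr0.
by rewrite mulrC ler_wpM2l// Af.
Qed.

(** Since the conditional weights sum to 1, the observed indicator can enter the average. The
    resulting difference changes sign when old and new color are exchanged. *)
Lemma vertex_excessE x s u : x \in hcolorings H G ->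
  vertex_excess H G b x s u = \sum_(t | allowed H G x u t)
    gibbs (allowed H G x u) (color_param b) t * ((x u == s)%:R - (t == s)%:R).
Proof.
move=> hx; under eq_bigr do rewrite mulrBr.
rewrite sumrB -mulr_suml (gibbs_sum1 _ (allowed_self u hx)) mul1r.
congr (_ - _); rewrite big_mkcond (bigD1 s)//= eqxx big1 ?addr0.
  by case: ifP; rewrite ?mul0r// mul1r mulr1.
by move=> t /negbTE->; rewrite mulr0 if_same.
Qed.

Lemma vertex_excess_le1 x s u : x \in hcolorings H G ->
  `|vertex_excess H G b x s u| <= 1.
Proof.
move=> hx; rewrite vertex_excessE//; apply: le_trans (ler_norm_sum _ _ _) _.
rewrite -[leRHS](gibbs_sum1 (color_param b) (allowed_self u hx)).
apply: ler_sum => t _; rewrite normrM (ger0_norm (gibbs_ge0 _ _ _)).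
rewrite ler_piMr ?gibbs_ge0//.
by case: eqP; case: eqP => _ _ /=; rewrite ?subrr ?subr0 ?sub0r ?normrN ?normr0 ?normr1.
Qed.

Lemma eq_gibbs (T : finType) (A A' : pred T) (f : T -> R) :
  A =1 A' -> gibbs A f =1 gibbs A' f.
Proof. by move=> AA' t; rewrite /gibbs /gibbs_part (eq_bigl _ _ AA'). Qed.

(* Resampling the color at [u] is reversible: exchanging the old and the new
   color preserves the weight and negates the excess. *)
Lemma vertex_excess_orth s u (g : coloring q N -> R) :
  (forall x t, g (recolor x u t) = g x) ->
  \sum_x pmf x * (vertex_excess H G b x s u * g x) = 0.
Proof.
move=> gu; pose F (p : coloring q N * 'I_q) : R :=
  if (p.1 \in hcolorings H G) && (recolor p.1 u p.2 \in hcolorings H G) then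
    pmf p.1 * gibbs (allowed H G p.1 u) (color_param b) p.2 *
    g p.1 * ((p.1 u == s)%:R - (p.2 == s)%:R)
  else 0.
pose phi (p : coloring q N * 'I_q) := (recolor p.1 u p.2, p.1 u).
have phiK : involutive phi.
  case=> x t; rewrite /phi /= ffunE eqxx; congr (_, _).
  by apply/ffunP => v; rewrite !ffunE; case: eqVneq => // ->.
have Fphi p : F (phi p) = - F p.
  rewrite /F -[(phi p).2]/(p.1 u) -[recolor (phi p).1 u (p.1 u)]/((phi (phi p)).1).
  rewrite phiK andbC; case: p => x t /=.
  case: ifP => [/andP[hx]|_]; last by rewrite oppr0.
  rewrite recolor_hcolorings// => ht.
  rewrite gu ffunE eqxx hcol_pmf_recolor//.
  (* No vertex is its own neighbor, so recoloring [u] leaves the colors allowed at [u] unchanged. *)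
  have ha := @allowed_recolor q N H G x u u t.
  rewrite G_irr in ha; rewrite (eq_gibbs _ (ha isT)).
  rewrite /gibbs; have Z0 := gibbs_part_gt0 (color_param b) ht.
  field.
  by rewrite !gt_eqF ?expR_gt0.
have -> : \sum_x pmf x * (vertex_excess H G b x s u * g x) = \sum_p F p.
  rewrite [RHS](eq_bigr (fun p => F (p.1, p.2))); last by case.
  rewrite -(pair_bigA _ (fun x t => F (x, t))) /=.
  apply: eq_bigr => x _; have [hx|hx] := boolP (x \in hcolorings H G); last first.
    by rewrite hcol_pmf_out// mul0r big1// => t _; rewrite /F /= (negbTE hx).
  rewrite vertex_excessE// mulr_suml mulr_sumr big_mkcond; apply: eq_bigr => t _.
  rewrite /F /= hx recolor_hcolorings//=; case: ifP => // _; ring.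
have : \sum_p F p = - \sum_p F p.
  rewrite {1}(reindex_inj (inv_inj phiK)) -sumrN.
  by apply: eq_bigr => p _; exact: Fphi.
by move: (\sum_p _) => S; lra.
Qed.

Lemma vertex_excess_recolor x s u v t : u != v -> ~~ G v u ->
  vertex_excess H G b (recolor x u t) s v = vertex_excess H G b x s v.
Proof.
move=> uv vu; have ha := allowed_recolor H x t vu.
by rewrite /vertex_excess (eq_gibbs _ ha) ha ffunE [v == u]eq_sym (negbTE uv).
Qed.

(** In the expanded square, distinct non-adjacent pairs contribute zero; every other pair
    contributes at most 1, and [u] is in [1 + degree G u] of them. *)
Lemma color_excess_second_moment s : hcolorings H G != finset.set0 ->
  \sum_x pmf x * color_excess H G b x s ^+ 2 <=
  \sum_u (1 + (degree G u)%:R).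
Proof.
move=> h0.
have -> : \sum_x pmf x * color_excess H G b x s ^+ 2 = \sum_u \sum_v
    \sum_x pmf x * (vertex_excess H G b x s u * vertex_excess H G b x s v).
  under [RHS]eq_bigr do rewrite exchange_big.
  rewrite exchange_big; apply: eq_bigr => x _ /=.
  rewrite expr2 /color_excess mulr_suml mulr_sumr; apply: eq_bigr => u _.
  by rewrite -mulr_sumr -mulr_sumr.
apply: ler_sum => u _.
apply: (@le_trans _ _ (\sum_v ((v == u)%:R + (G u v)%:R))); last first.
  rewrite big_split /=; apply: lerD.
    by rewrite (bigD1 u)//= eqxx big1 ?addr0// => v /negbTE->.
  rewrite -natr_sum ler_nat /degree -sum1dep_card [leqRHS]big_mkcond.
  by apply: leq_sum => v _ /=; case: (G u v).
apply: ler_sum => v _.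
have [/andP[vu Guv]|] := boolP ((u != v) && ~~ G v u).
  rewrite vertex_excess_orth; first by rewrite addr_ge0.
  by move=> x t; exact: vertex_excess_recolor.
rewrite negb_and !negbK G_sym => huv.
apply: (@le_trans _ _ 1); last first.
  by case/orP: huv => [/eqP->|->]; rewrite ?eqxx ?lerDl ?lerDr.
rewrite -(hcol_pmf_sum1 h0); apply: ler_sum => x _.
have [hx|hx] := boolP (x \in hcolorings H G); last first.
  by rewrite hcol_pmf_out// mul0r.
rewrite ler_piMr ?hcol_pmf_ge0//; apply: le_trans (ler_norm _) _.
by rewrite normrM mulr_ile1 ?vertex_excess_le1.
Qed.

Lemma color_excess_prob (c : R) : hcolorings H G != finset.set0 -> 0 < c ->
  prob (fun x => [exists s, c <= `|color_excess H G b x s|]) <=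
  q%:R * (\sum_u (1 + (degree G u)%:R)) / c ^+ 2.
Proof.
move=> h0 c0; apply: le_trans (hcol_prob_exists _) _.
rewrite -[q in q%:R]card_ord -mulrA mulr_natl -sumr_const; apply: ler_sum => s _.
rewrite ler_pdivlMr ?exprn_gt0// mulrC.
apply: le_trans (color_excess_second_moment s h0).
apply: hcol_prob_markov => x *; first exact: sqr_ge0.
by rewrite -[leRHS]real_normK ?num_real// lerXn2r ?nnegrE// ltW.
Qed.

End Moments.

(** * Every color occurs linearly often *)

Lemma card_agree_off (I T : finType) (t0 : T) (S : {set I}) (y : {ffun I -> T}) :
  (#|[set x : {ffun I -> T} | [forall v, (v \notin S) ==> (x v == y v)]]|
     <= #|T| ^ #|S|)%N.
Proof.
pose r (x : {ffun I -> T}) : {ffun I -> T} := [ffun v => if v \in S then x v else t0].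
rewrite -(card_pffun_on t0 S predT) -(card_in_imset (f := r)); last first.
  move=> x x'; rewrite !inE => /forallP hx /forallP hx' /ffunP rx.
  apply/ffunP => v; have := rx v; rewrite !ffunE.
  case: ifP => // vS _; have := hx v; have := hx' v; rewrite vS /=.
  by move=> /eqP-> /eqP->.
apply/subset_leq_card/fintype.subsetP => _ /imsetP[x _ ->].
apply/pffun_onP; split => //; apply/supportP => v /negbTE vS.
by rewrite ffunE vS.
Qed.

Section ColorCounts.
Variables (R : realType) (q N : nat) (H : rel 'I_q) (G : rel 'I_N).
Hypotheses (H_sym : symmetric H) (G_sym : symmetric G) (G_irr : irreflexive G).
Variables (b : 'rV[R]_q.-1) (t0 : 'I_q).
Hypothesis t0_unc : unconstrained H t0.
Implicit Types (x y : coloring q N) (u v : 'I_N) (s t : 'I_q).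

Local Notation pmf := (hcol_pmf H G b).
Local Notation prob := (hcol_prob H G b).

Definition star u : {set 'I_N} := u |: [set v | G u v].

Definition recolor_star x u s : coloring q N :=
  [ffun v => if v == u then s else if G u v then t0 else x v].

Definition low_degree (D : nat) : {set 'I_N} := [set u | (degree G u <= D)%N].

Definition low_count D s x : nat := #|[set u in low_degree D | x u == s]|.

Lemma recolor_star_off x u s v : v \notin star u -> recolor_star x u s v = x v.
Proof. by rewrite !inE ffunE negb_or => /andP[/negbTE-> /negbTE->]. Qed.

Lemma card_star u : #|star u| = (degree G u).+1.
Proof. by rewrite cardsU1 inE G_irr. Qed.

Lemma hcolorings_neq0 : hcolorings H G != finset.set0.
Proof.
by apply/set0Pn; exists [ffun=> t0]; apply/hcoloringsP => u v _; rewrite !ffunE.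
Qed.

Lemma recolor_star_hcolorings x u s : x \in hcolorings H G ->
  recolor_star x u s \in hcolorings H G.
Proof.
move=> /hcoloringsP hx; apply/hcoloringsP => v w vw; rewrite !ffunE.
have [vu|vu] := eqVneq v u; have [wu|wu] := eqVneq w u.
- by move: vw; rewrite vu wu G_irr.
- by rewrite -vu vw H_sym; exact: t0_unc.
- by rewrite -wu G_sym vw; exact: t0_unc.
- case: ifP => _; first exact: t0_unc.
  by case: ifP => _; [rewrite H_sym; exact: t0_unc|exact: hx].
Qed.

(** At most [D.+1] vertices change color, each altering the exponent by at most twice the norm of
    [b]. *)
Lemma hcol_pmf_recolor_star D x u s : u \in low_degree D ->
  pmf x <= expR (`|b| *+ (2 * D.+1)) * pmf (recolor_star x u s).
Proof.
rewrite inE => uD; have [hx|hx] := boolP (x \in hcolorings H G); last first.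
  by rewrite hcol_pmf_out// mulr_ge0 ?expR_ge0 ?hcol_pmf_ge0.
rewrite /hcol_pmf hx recolor_star_hcolorings// mulrA.
rewrite ler_wpM2r ?invr_ge0 ?(ltW (hcol_partition_gt0 _ hx))//.
rewrite !hcol_weightE -expRD ler_expR -lerBlDr -sumrB.
rewrite (bigID [in star u]) /= [X in _ + X]big1 ?addr0; last first.
  by move=> v vu; rewrite recolor_star_off// subrr.
apply: (@le_trans _ _ (\sum_(v in star u) `|b| *+ 2)).
  apply: ler_sum => v _; apply: le_trans (ler_norm _) _.
  apply: le_trans (ler_normB _ _) _.
  by rewrite mulr2n lerD// color_param_le.
by rewrite sumr_const card_star -mulrnA ler_wpMn2l// leq_mul2l.
Qed.

Lemma low_count_recolor_star D x u s : u \in low_degree D ->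
  (low_count D s (recolor_star x u s) <= low_count D s x + D.+1)%N.
Proof.
rewrite inE => uD.
apply: (@leq_trans (#|[set v in low_degree D | x v == s]| + #|star u|)).
  rewrite -cardsUI; apply: leq_trans (leq_addr _ _).
  apply/subset_leq_card/fintype.subsetP => v.
  have [vu|vu] := boolP (v \in star u); first by rewrite finset.in_setU vu orbT.
  by rewrite finset.in_setU (negbTE vu) orbF 2!inE recolor_star_off// 2!inE.
by rewrite leq_add2l card_star.
Qed.

(* Pairs (x, u) with few s-colored vertices in x are mapped to
   [recolor_star x u s], whose s-colored vertices include [u]: the target
   therefore determines [u] up to few choices. *)
Lemma low_count_prob D s (m : nat) :
  #|low_degree D|%:R * prob (fun x => low_count D s x < m)%N <=
  expR (`|b| *+ (2 * D.+1)) * (q ^ D.+1)%:R * (m + D)%:R.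
Proof.
set C := expR _; have C0 : 0 <= C by exact: expR_ge0.
have p0 x : 0 <= pmf x := hcol_pmf_ge0 H G b x.
pose Q y := (low_count D s y <= m + D)%N.
have step u : u \in low_degree D ->
    prob (fun x => low_count D s x < m)%N <=
    C * (q ^ D.+1)%:R * \sum_(y | Q y && (y u == s)) pmf y.
  move=> uD; apply: (@le_trans _ _ (\sum_(x | (low_count D s x < m)%N)
      C * pmf (recolor_star x u s))).
    by apply: ler_sum => x _; exact: hcol_pmf_recolor_star.
  rewrite -mulr_sumr -mulrA ler_wpM2l//.
  rewrite (partition_big (fun x => recolor_star x u s)
      (fun y => Q y && (y u == s))) /=; last first.
    (* A count below [m] grows by at most [D.+1], hence stays at most [m + D]. *)
    move=> x xm; rewrite ffunE !eqxx andbT /Q.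
    apply: leq_trans (low_count_recolor_star x s uD) _.
    by rewrite addnS -addSn leq_add2r.
  rewrite mulr_sumr; apply: ler_sum => y _.
  rewrite (eq_bigr (fun=> pmf y)); last by move=> x /andP[_ /eqP->].
  rewrite sumr_const -[leLHS]mulr_natl ler_wpM2r// ler_nat.
  (* All preimages of [y] agree with [y] off the star of [u], which has at most [D.+1] vertices. *)
  apply: (@leq_trans (#|'I_q| ^ #|star u|)); last first.
    rewrite card_ord card_star; move: uD; rewrite inE => uD.
    by rewrite leq_pexp2l// (leq_trans _ (ltn_ord s)).
  apply: leq_trans (subset_leq_card _) (card_agree_off t0 (star u) y).
  apply/fintype.subsetP => x; rewrite unfold_in => /andP[_ /eqP xy].
  rewrite inE.
  by apply/forallP => v; apply/implyP => vu; rewrite -xy recolor_star_off.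
rewrite mulr_natl -sumr_const; apply: (le_trans (ler_sum _ step)).
rewrite -mulr_sumr ler_wpM2l ?mulr_ge0//.
rewrite (exchange_big_dep Q) /=; last by move=> u y _ /andP[].
rewrite -[leRHS]mulr1 -[X in _ <= _ * X](hcol_pmf_sum1 b hcolorings_neq0) mulr_sumr.
rewrite [leRHS](bigID Q) /= ler_wpDr//.
  by apply: sumr_ge0 => y _; rewrite mulr_ge0.
apply: ler_sum => y Qy; rewrite sumr_const -[leLHS]mulr_natl ler_wpM2r// ler_nat.
apply: leq_trans Qy; apply/subset_leq_card/fintype.subsetP => u.
by rewrite unfold_in => /andP[]; rewrite !inE => -> /andP[_ ->].
Qed.

Lemma color_count_prob D (m : nat) :
  #|low_degree D|%:R *
    prob (fun x => [exists s : 'I_q, color_count s x < m])%N <=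
  q%:R * (expR (`|b| *+ (2 * D.+1)) * (q ^ D.+1)%:R * (m + D)%:R).
Proof.
apply: (@le_trans _ _ (#|low_degree D|%:R *
    \sum_s prob (fun x => low_count D s x < m)%N)).
  rewrite ler_wpM2l//; apply: le_trans (hcol_prob_exists _ _ _ _).
  apply: hcol_prob_le => x _ /existsP[s hs]; apply/existsP; exists s.
  apply: leq_ltn_trans hs; apply/subset_leq_card/fintype.subsetP => u.
  by rewrite !inE => /andP[_ /eqP->].
rewrite mulr_sumr -[X in _ <= X%:R * _]card_ord [leRHS]mulr_natl -[leRHS]sumr_const.
by apply: ler_sum => s _; exact: low_count_prob.
Qed.

(** Markov's inequality: the other vertices have degree at least [D.+1], hence at least [2 * d], so
    they make up at most half of all vertices. *)
Lemma card_low_degree D (d : R) : \sum_u (degree G u)%:R <= d * N%:R ->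
  d *+ 2 <= D.+1%:R -> N%:R <= 2 * #|low_degree D|%:R :> R.
Proof.
move=> hd dD.
have h : D.+1%:R * #|~: low_degree D|%:R <= d * N%:R.
  apply: le_trans hd; rewrite mulr_natr -sumr_const big_mkcond; apply: ler_sum => u _.
  by rewrite !inE -ltnNge; case: ifP; rewrite ?ler_nat.
have := cardsC (low_degree D); rewrite card_ord => /(congr1 (GRing.natmul (1 : R))).
rewrite natrD; have : (0 : R) <= #|~: low_degree D|%:R by [].
have : (0 : R) <= #|low_degree D|%:R by [].
have : (0 : R) < D.+1%:R by [].
move: (N%:R : R) (#|low_degree D|%:R : R) (#|~: low_degree D|%:R : R) h.
move: (D.+1%:R : R) dD => D' dD n l l' h D0 l0 l'0 e.
have : D' * l' <= D' * (n / 2).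
  apply: le_trans h _; nra.
rewrite ler_pM2l//; lra.
Qed.

End ColorCounts.

(** * From finite tail bounds to consistency *)

Lemma norm2_le (R : realType) n (v : 'rV[R]_n) :
  norm2 v <= Num.sqrt n%:R * `|v|.
Proof.
rewrite -[`|v|]ger0_norm// -sqrtr_sqr -sqrtrM// ler_wsqrtr//.
rewrite mulr_natl -[X in _ <= _ *+ X]card_ord -sumr_const; apply: ler_sum => i _.
by rewrite -real_normK ?num_real// lerXn2r ?nnegrE// coord_le_norm.
Qed.

(** The limsup is caught between 0 and [e] for large [M], hence is finite there, so extended-real
    convergence reduces to a real estimate. *)
Lemma limn_esup_cvg0 (R : realType) (f : R -> nat -> R) :
  (forall M n, 0 <= f M n) ->
  (forall e : R, 0 < e -> exists M0, forall M, M0 < M ->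
    \forall n \near \oo, f M n <= e) ->
  limn_esup (fun n => (f M n)%:E) @[M --> +oo] --> 0%E.
Proof.
move=> f0 small.
have ge0 M : (0 <= limn_esup (fun n => (f M n)%:E))%E.
  by apply: limf_esup_ge0 => [|n]; [exact: filter_not_empty|rewrite lee_fin].
have le_e (e : R) : 0 < e -> \forall M \near +oo,
    (limn_esup (fun n => (f M n)%:E) <= e%:E)%E.
  move=> /small[M0 hM0]; exists M0; split; first exact: num_real.
  move=> M /hM0 hM; rewrite /limn_esup limf_esupE.
  apply: (@le_trans _ _ (ereal_sup [set (f M n)%:E | n in [set n | f M n <= e]])).
    by apply: ereal_inf_lbound; exists [set n | f M n <= e].
  by apply: ge_ereal_sup => _ [n /= fn <-]; rewrite lee_fin.
have fin_le M (e : R) : (limn_esup (fun n => (f M n)%:E) <= e%:E)%E ->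
    limn_esup (fun n => (f M n)%:E) \is a fin_num.
  move=> Me; rewrite fin_numElt (lt_le_trans (ltNyr 0) (ge0 M)).
  by rewrite (le_lt_trans Me (ltry e)).
apply/fine_cvgP; split.
  by have := le_e 1 ltr01; apply: filterS => M; exact: fin_le.
apply/cvgrPdist_le => e e0; have := le_e e e0; apply: filterS => M Me /=.
rewrite sub0r normrN ger0_norm ?fine_ge0//.
by rewrite -lee_fin fineK// (fin_le M e).
Qed.

(** The two terms bound two bad events: some color occurs fewer than [m] times, or some color excess
    is large. Off both, [mpl_estimate_near] applies. *)
Lemma mpl_tail (R : realType) (q N : nat) (H : rel 'I_q) (G : rel 'I_N)
    (H_sym : symmetric H) (G_sym : symmetric G) (G_irr : irreflexive G)
    (b : 'rV[R]_q.-1) (t0 : 'I_q) (t0_unc : unconstrained H t0)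
    (bhat : coloring q N -> 'rV[R]_q.-1) (mpl : mpl_estimate H G bhat)
    (D m : nat) (d r : R) :
  \sum_u (degree G u)%:R <= d * N%:R -> d *+ 2 <= D.+1%:R ->
  (0 < N)%N -> (0 < m)%N -> 0 < r -> r <= 1 ->
  hcol_prob H G b (fun x => r <= `|bhat x - b|) <=
  2 * q%:R * (expR (`|b| *+ (2 * D.+1)) * (q ^ D.+1)%:R) * ((m + D)%:R / N%:R) +
  q%:R * ((1 + d) * N%:R) /
    (m%:R * (expR (- `|b| *+ 2) / q%:R) * r / (64 * q%:R)) ^+ 2.
Proof.
move=> hd dD N0 m0 r0 r1.
have q0 : 0 < q%:R :> R by rewrite ltr0n (leq_trans _ (ltn_ord t0)).
have N0' : 0 < N%:R :> R by rewrite ltr0n.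
have m0' : 0 < m%:R :> R by rewrite ltr0n.
set c := _ / (64 * q%:R).
have c0 : 0 < c by rewrite !(mulr_gt0, divr_gt0, expR_gt0, invr_gt0).
pose A (x : coloring q N) := [exists s : 'I_q, (color_count s x < m)%N].
pose B (x : coloring q N) := [exists s : 'I_q, c <= `|color_excess H G b x s|].
apply: (@le_trans _ _ (hcol_prob H G b (predU A B))).
  apply: hcol_prob_le => x hx; rewrite leNgt; apply: contraNT => /=.
  rewrite negb_or !negb_exists => /andP[/forallP hA /forallP hB].
  apply: (mpl_estimate_near H_sym G_sym G_irr mpl hx t0_unc (m := m%:R)) => //.
    by move=> s; rewrite ler_nat leqNgt.
  (* The extra [q] in the denominator of [c] lets [q] excesses below [c] add up to less than the
     threshold. *)
  have -> : m%:R * (expR (- `|b| *+ 2) / q%:R) * r / 64 = \sum_(s < q) c.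
    rewrite sumr_const card_ord -[RHS]mulr_natl /c; field.
    by rewrite gt_eqF.
  apply: ltr_sum => [|s _]; last by rewrite ltNge.
  by apply/hasP; exists t0; rewrite ?mem_index_enum.
apply: le_trans (hcol_probU _ _ _ _ _) _; apply: lerD.
  have low := card_low_degree hd dD.
  have := color_count_prob H_sym G_sym G_irr b t0_unc D m.
  set K := _ * (q ^ _)%:R; set p := hcol_prob _ _ _ _ => hp.
  have p0 : 0 <= p by exact: hcol_prob_ge0.
  rewrite mulrA ler_pdivlMr//.
  have := ler_wpM2l p0 low; move: hp.
  move: (m + D)%:R (N%:R) (q%:R : R) (#|low_degree G D|%:R) => mD n qr l; nra.
apply: le_trans (color_excess_prob H_sym G_sym G_irr b (hcolorings_neq0 G t0_unc) c0) _.
rewrite ler_wpM2r ?invr_ge0 ?sqr_ge0// ler_wpM2l ?(ltW q0)//.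
by rewrite big_split /= sumr_const card_ord mulrDl mul1r lerD2l.
Qed.

Lemma average_degree_bounded (R : realType) (G : forall N, rel 'I_N) :
  (ereal_sup [set ((N%:R^-1 * \sum_(u < N) (degree (G N) u)%:R : R)%:E)
             | N in [set N | (1 <= N)%N]] < +oo)%E ->
  exists2 d : R, 0 <= d &
    forall N, (0 < N)%N -> \sum_(u < N) (degree (G N) u)%:R <= d * N%:R.
Proof.
set S := [set _ | _ in _] => supS.
have ub N : (0 < N)%N ->
    ((N%:R^-1 * \sum_(u < N) (degree (G N) u)%:R : R)%:E <= ereal_sup S)%E.
  by move=> N0; apply: ereal_sup_ubound; exists N.
have supS0 : (0 <= ereal_sup S)%E.
  apply: le_trans (ub 1%N isT); rewrite lee_fin mulr_ge0 ?invr_ge0//.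
  by apply: sumr_ge0.
have fS : ereal_sup S \is a fin_num by rewrite ge0_fin_numE.
exists (fine (ereal_sup S)) => [|N N0]; first exact: fine_ge0.
have := ub N N0; rewrite -[X in (_ <= X)%E]fineK// lee_fin => h.
by rewrite -ler_pdivrMr ?ltr0n// mulrC.
Qed.

Lemma tail_le_norm (R : realType) (q N : nat) (v : 'rV[R]_q.-1) (M : R) :
  (0 < q)%N -> (0 < N)%N -> M < Num.sqrt N%:R * norm2 v ->
  M / (Num.sqrt q%:R * Num.sqrt N%:R) <= `|v|.
Proof.
move=> q0 N0 /ltW hM; rewrite ler_pdivrMr; last first.
  by rewrite mulr_gt0 ?sqrtr_gt0 ?ltr0n.
apply: le_trans hM _; rewrite mulrA [leRHS]mulrC.
rewrite ler_wpM2l ?sqrtr_ge0// mulrC; apply: le_trans (norm2_le v) _.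
by rewrite ler_wpM2r// ler_wsqrtr// ler_nat leq_pred.
Qed.

(** Each term gets [e / 2]. In the first, [eps] makes the main part [e / 4] and large [N] absorbs
    [D.+1] into another [e / 4]. The second is at most [B / M ^+ 2], where [M >= 1] and
    [M >= 2 * B / e]. *)
Lemma tail_terms_le (R : realType) (q N m D : nat) (K d delta eps e M r : R) :
  (0 < q)%N -> (0 < N)%N -> 0 < K -> 0 <= d -> 0 < delta -> 0 < e -> 0 < eps ->
  eps = e / (4 * (2 * q%:R * K)) ->
  eps * N%:R <= m%:R -> m%:R <= eps * N%:R + 1 ->
  4 * (2 * q%:R * K) * D.+1%:R / e <= N%:R ->
  1 <= M ->
  2 * (64 ^+ 2 * q%:R ^+ 4 * (1 + d) / (eps ^+ 2 * delta ^+ 2)) / e <= M ->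
  r = M / (Num.sqrt q%:R * Num.sqrt N%:R) ->
  2 * q%:R * K * ((m + D)%:R / N%:R) +
  q%:R * ((1 + d) * N%:R) / (m%:R * delta * r / (64 * q%:R)) ^+ 2 <= e.
Proof.
rewrite -!(ltr0n R) => q0 N0 K0 d0 delta0 e0 eps0 epsE m1 m2 hN M1 hM rE.
have half : e / 2 + e / 2 = e by lra.
rewrite -[leRHS]half; apply: lerD.
  set K1 := 2 * q%:R * K in epsE hN *.
  have K10 : 0 < K1 by rewrite !mulr_gt0.
  have epsK : K1 * eps = e / 4 by rewrite epsE; field; rewrite gt_eqF.
  rewrite mulrA ler_pdivrMr// natrD; move: hN; rewrite ler_pdivrMr// -(natr1 D).
  have := ler_wpM2l (ltW K10) m2; rewrite mulrDr mulrA epsK.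
  move: (N%:R : R) (m%:R : R) (D%:R : R) N0 => n m' D' n0.
nra.
set B := _ / (eps ^+ 2 * _) in hM.
have sq0 : 0 < Num.sqrt (q%:R : R) by rewrite sqrtr_gt0.
have sN0 : 0 < Num.sqrt (N%:R : R) by rewrite sqrtr_gt0.
have sq2 : Num.sqrt (q%:R : R) ^+ 2 = q%:R by rewrite sqr_sqrtr ?ltW.
have sN2 : Num.sqrt (N%:R : R) ^+ 2 = N%:R by rewrite sqr_sqrtr ?ltW.
have M0 : 0 < M by lra.
have r0 : 0 < r by rewrite rE divr_gt0 ?mulr_gt0.
apply: (@le_trans _ _ (q%:R * ((1 + d) * N%:R) /
    (eps * N%:R * delta * r / (64 * q%:R)) ^+ 2)).
  have qdN : 0 <= q%:R * ((1 + d) * N%:R) by rewrite !mulr_ge0// addr_ge0.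
  rewrite ler_wpM2l//.
  have p1 : 0 < eps * N%:R * delta * r / (64 * q%:R).
    by rewrite !(mulr_gt0, invr_gt0).
  have p2 : eps * N%:R * delta * r / (64 * q%:R) <= m%:R * delta * r / (64 * q%:R).
    by rewrite !ler_pM2r ?invr_gt0 ?mulr_gt0.
  have p3 := lt_le_trans p1 p2.
  by rewrite lef_pV2 ?posrE ?exprn_gt0// lerXn2r// nnegrE ltW.
have -> : q%:R * ((1 + d) * N%:R) / (eps * N%:R * delta * r / (64 * q%:R)) ^+ 2
    = B / M ^+ 2.
  rewrite rE /B; move: sq0 sN0 sq2 sN2.
  move: (Num.sqrt q%:R) (Num.sqrt N%:R) => sq sN sq0 sN0 <- <-; field.
  by rewrite !gt_eqF.
have B0 : 0 <= B.
  apply: divr_ge0; last by rewrite mulr_ge0 ?sqr_ge0.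
  by apply: mulr_ge0; rewrite ?addr_ge0.
rewrite ler_pdivrMr ?exprn_gt0//; move: hM; rewrite ler_pdivrMr// expr2; nra.
Qed.

Theorem corollary2p10 (R : realType) (q : nat) (hq : (2 <= q)%N)
    (beta : 'rV[R]_q.-1)
    (H : rel 'I_q) (H_sym : symmetric H) (H_conn : connected_graph H)
    (H_ncomplete : H <> @complete_looped 'I_q)
    (H_unconstrained : exists s, unconstrained H s)
    (G : forall N : nat, rel 'I_N)
    (G_simple : forall N, (1 <= N)%N -> simple_graph (G N))
    (G_no_isolated : forall N, (2 <= N)%N -> no_isolated_vertex (G N))
    (G_degree :
      (ereal_sup [set ((N%:R^-1 * \sum_(u < N) (degree (G N) u)%:R : R)%:E)
                 | N in [set N | (1 <= N)%N]] < +oo)%E)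
    (bhat : forall N : nat, coloring q N -> 'rV[R]_q.-1)
    (bhat_mpl : forall N, (1 <= N)%N -> mpl_estimate H (G N) (bhat N)) :
  limn_esup (fun N =>
    (hcol_prob H (G N) beta
       (fun x => M < Num.sqrt N%:R * norm2 (bhat N x - beta)))%:E)
    @[M --> +oo] --> 0%E.
Proof.
have [t0 t0_unc] := H_unconstrained.
have q0 : (0 < q)%N by apply: leq_trans hq.
have [d d0 hd] := average_degree_bounded G_degree.
(* This degree cutoff leaves at least half of the vertices of low degree. *)
pose D := Num.bound (d *+ 2).
have dD : d *+ 2 <= D.+1%:R.
  rewrite (le_trans (ltW (archi_boundP _)))// ?mulrn_wge0//.
  by rewrite ler_nat leqnSn.
pose K : R := expR (`|beta| *+ (2 * D.+1)) * (q ^ D.+1)%:R.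
have K0 : 0 < K by rewrite mulr_gt0 ?expR_gt0// ltr0n expn_gt0 q0.
pose delta : R := expR (- `|beta| *+ 2) / q%:R.
have delta0 : 0 < delta by rewrite divr_gt0 ?expR_gt0 ?ltr0n.
apply: limn_esup_cvg0 => [M n|e e0]; first exact: hcol_prob_ge0.
pose eps : R := e / (4 * (2 * q%:R * K)).
have q0R : 0 < q%:R :> R by rewrite ltr0n.
have eps0 : 0 < eps by rewrite divr_gt0// mulr_gt0// mulr_gt0// mulr_gt0.
pose M1 : R := 2 * (64 ^+ 2 * q%:R ^+ 4 * (1 + d) / (eps ^+ 2 * delta ^+ 2)) / e.
exists (Num.max 1 M1) => M; rewrite gt_max => /andP[/ltW M_ge1 /ltW M_geM1].
near=> n.
have n0 : (0 < n)%N by near: n; exact: nbhs_infty_gt.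
have [G_sym G_irr] := G_simple n n0.
(* The successor keeps [m] positive and between [eps * n] and [eps * n + 1]. *)
pose m := (Num.truncn (eps * n%:R)).+1.
pose r : R := M / (Num.sqrt q%:R * Num.sqrt n%:R).
have epsn0 : 0 <= eps * n%:R by rewrite mulr_ge0// ltW.
have /andP[m_le m_ge] := truncn_itv epsn0.
have M0 : 0 < M by apply: lt_le_trans M_ge1.
have r0 : 0 < r by rewrite divr_gt0 ?mulr_gt0 ?sqrtr_gt0 ?ltr0n.
(* The variance expansion is valid only for perturbations of norm at most 1; [n >= M ^+ 2]
   suffices. *)
have r1 : r <= 1.
  rewrite ler_pdivrMr ?mulr_gt0 ?sqrtr_gt0 ?ltr0n// mul1r -sqrtrM//.
  rewrite -[M]ger0_norm ?(ltW M0)// -sqrtr_sqr ler_wsqrtr//.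
  apply: (@le_trans _ _ n%:R); last by rewrite ler_peMl// ler1n.
  by near: n; exact: nbhs_infty_ger.
apply: (@le_trans _ _ (hcol_prob H (G n) beta (fun x => r <= `|bhat n x - beta|))).
  by apply: hcol_prob_le => x _; exact: tail_le_norm.
apply: le_trans (mpl_tail H_sym G_sym G_irr beta t0_unc (bhat_mpl n n0)
  (m := m) (hd n n0) dD n0 isT r0 r1) _.
apply: (tail_terms_le q0 n0 K0 d0 delta0 e0 eps0 erefl _ _ _ M_ge1 M_geM1 erefl).
- exact: ltW.
- by rewrite -natr1 lerD2r.
- by near: n; exact: nbhs_infty_ger.
Unshelve. all: by end_near. Qed.
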